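(* Let $X$ be a finite set, let $q\in(0,1)$, and let $H$ be a hypergraph on vertex set $X$ with $\ell(H)\ge 1$ that is not $q$-small. Let $\epsilon\in(0,1)$ and let $p=48q\log_2\left(\frac{\ell(H)}{\epsilon}\right)$. Then \[\mathbb{P}(\exists\, S\in H\text{ such that }S\subseteq X_p)>1-\epsilon.\]
   Context: A hypergraph $H$ on a finite vertex set $X$ is a collection of subsets of $X$, called hyperedges. The upward closure of a hypergraph $G$ on $X$ is $\langle G\rangle=\{R\subseteq X:\exists\, S\in G\text{ such that }S\subseteq R\}$. For $q\in(0,1)$, $H$ is called $q$-small if there is a hypergraph $G$ on $X$ such that $H\subseteq\langle G\rangle$ and $\sum_{R\in G}q^{|R|}\le\frac12$ (here $G$ is allowed to contain the empty set, which contributes $q^0=1$, and $G$ may be empty). $\ell(H)$ denotes the size of the largest hyperedge of $H$. $X_p$ denotes a random subset of $X$ in which each element is included independently with probability $p$; if $p\ge 1$, then $X_p=X$. *)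

(* Defs.v *)
From mathcomp Require Import all_boot all_order all_algebra.
From mathcomp Require Import reals exp.

Set Implicit Arguments.
Unset Strict Implicit.
Unset Printing Implicit Defensive.

Import Order.TTheory GRing.Theory Num.Theory.

Local Open Scope ring_scope.

Notation hypergraph X := {set {set X}}.

Section Hypergraphs.
Variable X : finType.
Implicit Types G H : hypergraph X.

Definition upward_closure G : hypergraph X :=
  [set R : {set X} | [exists S in G, S \subset R]].

Definition q_small (K : realType) (q : K) H : Prop :=
  exists2 G : hypergraph X,
    H \subset upward_closure G & \sum_(R in G) q ^+ #|R| <= 1 / 2.

(* Equal to 0 when H is empty. *)
Definition ell H : nat := (\max_(S in H) #|S|)%N.

End Hypergraphs.

Section RandomSubset.
Variables (K : realType) (X : finType).

(* The law of X_p, a product of Bernoulli laws.  The parameter is capped at 1,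
   so that X_p = X almost surely when 1 <= p; the definition is meant for
   0 <= p only. *)
Definition random_subset_mass (p : K) (W : {set X}) : K :=
  \prod_(x : X) (if x \in W then Num.min p 1 else 1 - Num.min p 1).

Definition random_subset_prob (p : K) (E : pred {set X}) : K :=
  \sum_(W : {set X} | E W) random_subset_mass p W.

Lemma random_subset_mass_ge0 (p : K) (W : {set X}) :
  0 <= p -> 0 <= random_subset_mass p W.
Proof.
move=> p_ge0; apply: prodr_ge0 => x _; case: ifP => _.
  by rewrite le_min p_ge0 ler01.
by rewrite subr_ge0 ge_min lexx orbT.
Qed.

Lemma random_subset_probT (p : K) : random_subset_prob p predT = 1.
Proof.
rewrite /random_subset_prob /random_subset_mass.
rewrite -(bigA_distr _ _ (fun=> Num.min p 1) (fun=> 1 - Num.min p 1)).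
by apply: big1 => x _; rewrite /= addrC subrK.
Qed.

Lemma random_subset_prob_ge1 (p : K) (E : pred {set X}) :
  1 <= p -> random_subset_prob p E = (E [set: X])%:R.
Proof.
move=> p_ge1.
have massT : random_subset_mass p [set: X] = 1.
  by apply: big1 => x _; rewrite inE min_r.
have mass0 (W : {set X}) : W != [set: X] -> random_subset_mass p W = 0.
  rewrite -subTset => /subsetPn[x _ xNW].
  by rewrite /random_subset_mass (bigD1 x) //= (negbTE xNW) min_r // subrr mul0r.
rewrite /random_subset_prob.
case ET: (E [set: X]).
  by rewrite (bigD1 [set: X]) //= massT big1 ?addr0 // => W /andP[_ /mass0].
by apply: big1 => W EW; apply: mass0; apply: contraTneq EW => ->; rewrite ET.
Qed.

End RandomSubset.

Definition log2 (K : realType) (x : K) : K := ln x / ln 2.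

(* Main.v *)
(* For a set W, let link H W consist of the inclusion-minimal sets S \ W with
   S in H (minimal fragments).  Every edge contains a minimal fragment, so
   covers of the fragments are covers of H.  If T is a minimal fragment for W,
   put Z = W \cup T: any edge inside Z contains T.  Hence Z determines T up to
   2^l choices when edges have size at most l, and since
   P(W) p^|T| <= P(Z), sampling W at density 24 q makes the expected cost of
   the fragments of size at least m at most 2^l / 24^m.

   With 2^k <= l < 2^(k+1) and m = 2^k, a round of density 24 q is good when
   the fragments of size at least m are cheap; the remaining fragments then
   form a hypergraph with k decreased by 1 whose covers are still expensive.
   A bad round, of probability at most 1/4, is discarded.  Induction on k and
   on the number of rounds bounds the failure probability at density p by
   4^k 2^(-p / (24 q)); the case k = 0 is an exact computation with
   singletons.  For p = 48 q log_2 (l / eps) the bound is at most eps^2. *)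

Require Import Defs.
From mathcomp Require Import all_boot all_order all_algebra.
From mathcomp Require Import reals sequences exp.
From mathcomp Require Import ring lra.

Import Order.TTheory GRing.Theory Num.Theory.

Local Open Scope ring_scope.

Section RandomSubsets.
Set Implicit Arguments.
Unset Strict Implicit.
Context {K : realType} {X : finType}.
Implicit Types (p q r c u v : K) (A S T W Z : {set X}) (G H : hypergraph X).

(** * Bernoulli random subsets and unions of independent samples *)

Lemma sum_prod_mem (f : X -> bool -> K) :
  \sum_(W : {set X}) \prod_x f x (x \in W) = \prod_x (f x true + f x false).
Proof.
rewrite (bigA_distr 1 _ (f^~ true) (f^~ false)) big_mkcond /=.
by apply: eq_bigr => W _; apply: eq_bigr => x _; case: (x \in W).
Qed.

Lemma random_subset_massE p W : p <= 1 ->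
  random_subset_mass p W = \prod_x (if x \in W then p else 1 - p).
Proof. by move=> p1; rewrite /random_subset_mass min_l. Qed.

Lemma prod_if_mem p T : \prod_x (if x \in T then p else 1) = p ^+ #|T|.
Proof. by rewrite -big_mkcond prodr_const. Qed.

Lemma random_subset_massU p1 p2 W : 0 <= p1 <= 1 -> 0 <= p2 <= 1 ->
  \sum_W1 \sum_W2 (W1 :|: W2 == W)%:R *
      (random_subset_mass p1 W1 * random_subset_mass p2 W2)
  = random_subset_mass (1 - (1 - p1) * (1 - p2)) W.
Proof.
move=> /andP[p1_0 p1_1] /andP[p2_0 p2_1].
pose f1 (b : bool) := if b then p1 else 1 - p1.
pose f2 (b : bool) := if b then p2 else 1 - p2.
(* The condition [W1 :|: W2 == W] splits into one condition per element, so the double sum becomes a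
   product over [x] of sums over four pairs of Booleans. *)
pose f12 x b1 b2 := ((b1 || b2) == (x \in W))%:R * (f1 b1 * f2 b2) : K.
transitivity (\sum_(W1 : {set X}) \sum_(W2 : {set X})
    \prod_x f12 x (x \in W1) (x \in W2)).
  apply: eq_bigr => W1 _; apply: eq_bigr => W2 _.
  rewrite !random_subset_massE // /f12 !big_split /=; congr (_ * _).
  have [<-|] := eqVneq; first by rewrite big1 // => x _; rewrite inE eqxx.
  move=> neqW; have [x xW] : exists x, (x \in W1 :|: W2) != (x \in W).
    by apply/existsP; apply: contraNT neqW => /existsPn eqW;
      apply/eqP/setP => x; apply/eqP/negPn.
  by rewrite (bigD1 x) //= -in_setU (negbTE xW) mul0r.
under eq_bigr => W1 _ do rewrite (sum_prod_mem (fun x => f12 x (x \in W1))).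
rewrite (sum_prod_mem (fun x b => f12 x b true + f12 x b false)).
rewrite random_subset_massE; last by nra.
by apply: eq_bigr => x _; rewrite /f12 /f1 /f2; case: (x \in W) => /=; lra.
Qed.

Lemma random_subset_probU p1 p2 (E : pred {set X}) :
  0 <= p1 <= 1 -> 0 <= p2 <= 1 ->
  random_subset_prob (1 - (1 - p1) * (1 - p2)) E =
  \sum_W1 random_subset_mass p1 W1 *
    random_subset_prob p2 (fun W2 => E (W1 :|: W2)).
Proof.
move=> hp1 hp2; rewrite /random_subset_prob.
under eq_bigr => W _ do rewrite -random_subset_massU //.
rewrite exchange_big /=; apply: eq_bigr => W1 _.
rewrite exchange_big /= mulr_sumr [RHS]big_mkcond; apply: eq_bigr => W2 _ /=.
rewrite -mulr_suml; case: ifP => EW.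
  rewrite (bigD1 (W1 :|: W2)) //= eqxx big1 ?addr0 ?mul1r //.
  by move=> W /andP[_ /negbTE]; rewrite eq_sym => ->.
rewrite big1 ?mul0r // => W; case: eqP => // <-; by rewrite EW.
Qed.

Lemma random_subset_prob_le p (E F : pred {set X}) : 0 <= p ->
  (forall W, E W -> F W) -> random_subset_prob p E <= random_subset_prob p F.
Proof.
move=> p0 EF; rewrite /random_subset_prob big_mkcond [leRHS]big_mkcond.
apply: ler_sum => W _; case: ifP => [/EF ->//|_].
by case: ifP => // _; apply: random_subset_mass_ge0.
Qed.

Lemma random_subset_prob_le1 p (E : pred {set X}) : 0 <= p ->
  random_subset_prob p E <= 1.
Proof.
by move=> p0; rewrite -(random_subset_probT X p); apply: random_subset_prob_le.
Qed.

Lemma random_subset_probC p (E : pred {set X}) :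
  random_subset_prob p E + random_subset_prob p (fun W => ~~ E W) = 1.
Proof. by rewrite -(random_subset_probT X p) [RHS](bigID E). Qed.

Lemma random_subset_prob_disjoint p A : 0 <= p <= 1 ->
  random_subset_prob p (fun W => [disjoint A & W]) = (1 - p) ^+ #|A|.
Proof.
move=> /andP[p0 p1]; rewrite /random_subset_prob.
pose f x (b : bool) := if b then (x \notin A)%:R * p else 1 - p.
transitivity (\sum_(W : {set X}) \prod_x f x (x \in W)).
  rewrite big_mkcond; apply: eq_bigr => W _; rewrite random_subset_massE //.
  case: ifP => [AW|/negbT].
    apply: eq_bigr => x _; rewrite /f; case: ifP => // xW.
    by rewrite (disjointFl AW xW) mul1r.
  move/pred0Pn=> [x /= /andP[xA xW]].
  by rewrite (bigD1 x) //= /f xW xA !mul0r.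
rewrite sum_prod_mem -prod_if_mem; apply: eq_bigr => x _.
by rewrite /f; case: (x \in A) => /=; lra.
Qed.

Lemma random_subset_mass_exp_le p W T : 0 <= p <= 1 ->
  random_subset_mass p W * p ^+ #|T| <= random_subset_mass p (W :|: T).
Proof.
move=> /andP[p0 p1]; rewrite !random_subset_massE // -prod_if_mem -big_split /=.
apply: ler_prod => x _; rewrite inE.
by case: (x \in W); case: (x \in T) => /=; nra.
Qed.

(** * Minimal fragments and the cost of covers *)

Definition avoids H W := ~~ [exists S in H, S \subset W].

Definition link H W : hypergraph X :=
  [set T | minset (mem [set S :\: W | S in H]) T].

Lemma link_cover H W S : S \in H -> exists2 T, T \in link H W & T \subset S.
Proof.
move=> SH.
have [T mT TS] := @minset_exists _ (mem [set S :\: W | S in H]) _ (imset_f _ SH).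
by exists T; rewrite ?inE // (subset_trans TS) // subsetDl.
Qed.

(** An edge inside [W :|: T] leaves a trace [S :\: W] inside [T]; by minimality this trace is [T]
    itself. *)
Lemma linkP H W T : T \in link H W ->
  (exists2 S, S \in H & T = S :\: W)
  /\ (forall S, S \in H -> S \subset W :|: T -> T \subset S).
Proof.
rewrite inE => /minsetP[/imsetP TS Tmin]; split=> // S SH; rewrite -subDset => ST.
by rewrite -(Tmin _ (imset_f _ SH) ST) subsetDl.
Qed.

(** Sampling has density [p] but costs are taken at the lower density [p * r]: the factor
    [p ^+ #|T|] is absorbed in passing from [W] to [W :|: T], and [r ^+ #|T|] is the gain. *)
Lemma expected_link_cost_le p r H m n : 0 <= p <= 1 -> 0 <= r <= 1 ->
  (forall S, S \in H -> (#|S| <= n)%N) ->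
  \sum_W random_subset_mass p W *
    (\sum_(T in link H W | (m <= #|T|)%N) (p * r) ^+ #|T|)
  <= 2 ^+ n * r ^+ m.
Proof.
move=> hp /andP[r0 r1] Hn; have /andP[p0 p1] := hp.
(* A fragment is disjoint from its [W], so [W] is recovered as [Z :\: T] and the sum over [W] can be
   reindexed by [Z]. *)
pose Q T Z := (T \in link H (Z :\: T)) && (((Z :\: T) :|: T) == Z).
apply: (@le_trans _ _ (\sum_W \sum_(T in link H W | (m <= #|T|)%N)
    random_subset_mass p (W :|: T) * r ^+ m)).
  apply: ler_sum => W _; rewrite mulr_sumr; apply: ler_sum => T /andP[_ mT].
  rewrite exprMn mulrA; apply: ler_pM.
  - by rewrite mulr_ge0 ?exprn_ge0 ?random_subset_mass_ge0.
  - exact: exprn_ge0.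
  - exact: random_subset_mass_exp_le.
  - exact: ler_wiXn2l.
rewrite (exchange_big_dep (fun T => (m <= #|T|)%N)) /=; last by move=> W T _ /andP[].
have -> : \sum_(T : {set X} | (m <= #|T|)%N)
      \sum_(W | (T \in link H W) && (m <= #|T|)%N)
        random_subset_mass p (W :|: T) * r ^+ m
  = \sum_Z \sum_(T : {set X} | (m <= #|T|)%N && Q T Z)
      random_subset_mass p Z * r ^+ m.
  rewrite [RHS](exchange_big_dep (fun T => (m <= #|T|)%N)) /=; last first.
    by move=> Z T _ /andP[].
  apply: eq_bigr => T mT.
  rewrite (reindex_onto (fun Z => Z :\: T) (fun W => W :|: T)) /=; last first.
    move=> W /andP[/linkP[[S _ ->] _] _].
    apply/setP => x; rewrite !inE.
    by case: (x \in W); case: (x \in S).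
  by rewrite mT; apply: eq_big => [Z|Z /andP[_ /eqP->]]; rewrite ?andbT.
have -> : 2 ^+ n * r ^+ m
    = \sum_(Z : {set X}) random_subset_mass p Z * (2 ^+ n * r ^+ m) :> K.
  by rewrite -mulr_suml -/(random_subset_prob p predT) random_subset_probT mul1r.
apply: ler_sum => Z _; rewrite -mulr_sumr sumr_const.
apply: ler_wpM2l; first exact: random_subset_mass_ge0.
rewrite -[leLHS]mulr_natl; apply: ler_wpM2r; first exact: exprn_ge0.
(* One admissible fragment yields an edge [S0] inside [Z]; every admissible fragment is then a
   subset of [S0]. *)
case: (pickP [pred T : {set X} | (m <= #|T|)%N && Q T Z]) => [T0|Q0]; last first.
  by rewrite eq_card0 ?exprn_ge0.
move=> /= /andP[_ /andP[/linkP[[S0 S0H T0E] _] /eqP ZE]].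
have S0Z : S0 \subset Z by rewrite -ZE -subDset -T0E.
rewrite -natrX ler_nat (leq_trans _ (leq_pexp2l _ (Hn _ S0H))) // -card_powerset.
apply/subset_leq_card/subsetP => T /andP[_ /andP[/linkP[_ Tmin] /eqP ZT]].
by rewrite powersetE Tmin // ZT.
Qed.

(** Threshold 1/2 is the failure of [q_small]. The threshold is left free because each good round
    spends part of it. *)
Definition covers_exceed q c H :=
  forall G, H \subset upward_closure G -> c < \sum_(R in G) q ^+ #|R|.

Definition small_link H W m := [set T in link H W | (#|T| < m)%N].

Lemma avoids_small_link H m W1 W2 :
  avoids H (W1 :|: W2) -> avoids (small_link H W1 m) W2.
Proof.
apply: contraNN => /existsP[T /andP[/setIdP[/linkP[[S SH ->] _] _] TW2]].
by apply/existsP; exists S; rewrite SH -subDset.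
Qed.

(** Adding the large fragments to a cover of the small ones gives a cover of [H], at extra cost at
    most [b]. *)
Lemma covers_exceed_small_link q b c H W m : 0 <= q ->
  covers_exceed q (b + c) H ->
  \sum_(T in link H W | (m <= #|T|)%N) q ^+ #|T| <= b ->
  covers_exceed q c (small_link H W m).
Proof.
move=> q0 Hbc costb G GH.
pose U := [set T in link H W | (m <= #|T|)%N].
have /Hbc : H \subset upward_closure (G :|: U).
  apply/subsetP => S SH; have [T TL TS] := link_cover W SH.
  rewrite inE; apply/existsP; have [mT|Tm] := leqP m #|T|.
    by exists T; rewrite TS in_setU [T \in U]inE TL mT orbT.
  have /(subsetP GH) : T \in small_link H W m by apply/setIdP.
  rewrite inE => /existsP[R /andP[RG RT]].
  by exists R; rewrite in_setU RG (subset_trans RT TS).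
have UE : \sum_(T in U) q ^+ #|T| <= b.
  by apply: le_trans costb; rewrite (eq_bigl _ _ (in_set _)).
have : \sum_(R in G :|: U) q ^+ #|R|
    <= \sum_(R in G) q ^+ #|R| + \sum_(R in U) q ^+ #|R|.
  rewrite !(big_mkcond (fun R => R \in _)) -big_split /=; apply: ler_sum => R _.
  have := exprn_ge0 #|R| q0; rewrite in_setU.
  by case: (R \in G); case: (R \in U) => /=; lra.
lra.
Qed.

Lemma markov_random_subset p b (f : {set X} -> K) : 0 <= p -> 0 < b ->
  (forall W, 0 <= f W) ->
  b * random_subset_prob p (fun W => b < f W)
  <= \sum_W random_subset_mass p W * f W.
Proof.
move=> p0 b0 f0; rewrite mulr_sumr big_mkcond; apply: ler_sum => W _.
have m0 := random_subset_mass_ge0 W p0; have := f0 W.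
by case: ifP => [bf|_]; nra.
Qed.

(** * The decay rate and the case of singletons *)

Lemma ln2_le1 : ln (2 : K) <= 1.
Proof.
rewrite -ler_expR lnK ?posrE //; apply: le_trans (expR_ge1Dx 1).
by rewrite -natr1.
Qed.

(** This is 2^(-u/24): with [u = p / q], each round of density [24 * q] halves it. *)
Definition decay (u : K) : K := expR (- (ln 2 / 24 * u)).

Lemma decay_ge0 u : 0 <= decay u. Proof. exact: expR_ge0. Qed.

Lemma decay_anti u v : u <= v -> decay v <= decay u.
Proof.
by move=> uv; rewrite ler_expR lerN2 ler_wpM2l // divr_ge0 // ln_ge0 // ler1n.
Qed.

Lemma decayB24 u : decay (u - 24) = 2 * decay u.
Proof.
rewrite -[X in X * _](@lnK K 2) ?posrE // -expRD; congr expR.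
by field.
Qed.

Lemma decay24 : decay 24 = 1 / 2.
Proof.
have := decayB24 24; rewrite subrr /decay mulr0 oppr0 expR0; lra.
Qed.

(** The singleton edges form a cover, so [q * #|A| > 1/4]; missing all of [A] has probability at
    most exp(-p|A|), and [ln 2 / 24] is below 1/4. *)
Lemma avoid_singletons_le p q H : 0 < q -> 0 <= p <= 1 ->
  (forall S, S \in H -> (#|S| <= 1)%N) -> covers_exceed q (1 / 4) H ->
  random_subset_prob p (avoids H) <= decay (p / q).
Proof.
move=> q0 hp H1 Hc; have /andP[p0 p1] := hp.
have [H0|H0] := boolP (set0 \in H).
  rewrite /random_subset_prob big_pred0 ?decay_ge0 // => W; apply/negbTE.
  by rewrite negbK; apply/existsP; exists set0; rewrite H0 sub0set.
pose A := [set x | [set x] \in H].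
have cardA : 1 / 4 < q * #|A|%:R.
  have /Hc : H \subset upward_closure [set [set x] | x in A].
    apply/subsetP => S SH; rewrite inE; apply/existsP; exists S.
    have /cards1P[x Sx] : #|S| == 1%N.
      rewrite eqn_leq H1 // lt0n cards_eq0.
      by apply: contraNneq H0 => <-.
    by rewrite subxx andbT Sx imset_f // inE -Sx.
  rewrite big_imset /=; last by move=> x y _ _ /set1_inj.
  by under eq_bigr => x _ do rewrite cards1 expr1; rewrite sumr_const mulr_natr.
apply: (@le_trans _ _ ((1 - p) ^+ #|A|)).
  rewrite -random_subset_prob_disjoint //; apply: random_subset_prob_le => // W.
  apply: contraNT => /pred0Pn[x /= /andP[xA xW]]; apply/existsP.
  by exists [set x]; rewrite sub1set xW andbT; move: xA; rewrite inE.
apply: (@le_trans _ _ (expR (- p) ^+ #|A|)).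
  by apply: lerXn2r; rewrite ?nnegrE ?expR_ge0 ?subr_ge0 // expR_ge1Dx.
rewrite -expRM_natr ler_expR mulNr lerN2.
have u0 : 0 <= p / q by rewrite divr_ge0 // ltW.
have -> : p * #|A|%:R = q * #|A|%:R * (p / q).
  by rewrite mulrAC mulrCA divff ?gt_eqF // mulr1.
by apply: ler_wpM2r => //; have := ln2_le1; lra.
Qed.

(** * One round, and the induction over rounds *)

(** Here 6 is 24 / 2^2: edges of size at most 2^(k+2) and fragments of size at least 2^(k+1) have
    expected cost at most 6^-(2^(k+1)), which must be a quarter of the budget 2^-(k+3) for Markov's
    inequality to give 1/4. *)
Lemma six_exp_le k : (4 / 6 ^+ (2 ^ k.+1) : K) <= (1 / 2) ^+ k.+3.
Proof.
have h : (2 ^ k.+3 * 4 <= 6 ^ (2 ^ k.+1))%N.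
  apply: leq_trans (_ : 6 ^ k.+2 <= _)%N; last by rewrite leq_exp2l // ltn_expl.
  elim: k => // k IH; rewrite expnS [leqRHS]expnS -mulnA.
  exact: leq_mul.
rewrite expr_div_n expr1n -!natrX ler_pdivrMr ?ltr0n ?expn_gt0 //.
rewrite mul1r mulrC ler_pdivlMr ?ltr0n ?expn_gt0 //.
by rewrite mulrC -natrM ler_nat.
Qed.

(* A good round contributes [c1] and a discarded one [c2]. *)
Lemma avoid_round_le p q (c1 c2 : K) H k : 0 < q -> 24 * q <= 1 -> 0 <= p <= 1 ->
  (forall S, S \in H -> (#|S| < 2 ^ k.+2)%N) ->
  covers_exceed q (1 / 2 - (1 / 2) ^+ k.+3) H ->
  (forall H', (forall S, S \in H' -> (#|S| < 2 ^ k.+1)%N) ->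
     covers_exceed q (1 / 2 - (1 / 2) ^+ k.+2) H' ->
     random_subset_prob p (avoids H') <= c1) ->
  0 <= c1 -> 0 <= c2 -> random_subset_prob p (avoids H) <= c2 ->
  random_subset_prob (1 - (1 - 24 * q) * (1 - p)) (avoids H) <= c1 + c2 / 4.
Proof.
move=> q0 q1 hp Hk Hc IH c1_0 c2_0 Hc2.
have /andP[p0 p1] := hp; have hq : 0 <= 24 * q <= 1 by lra.
have /andP[q24_0 _] := hq.
pose b : K := (1 / 2) ^+ k.+3.
have b0 : 0 < b by rewrite exprn_gt0 // divr_gt0.
(* The threshold drops by exactly the budget [b] allowed for large fragments. *)
have cE : 1 / 2 - (1 / 2) ^+ k.+3 = b + (1 / 2 - (1 / 2) ^+ k.+2) :> K.
  by rewrite /b [X in _ = _ + (_ - X)](_ : _ = 2 * b) /b ?exprS; lra.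
rewrite cE in Hc.
pose f W := \sum_(T in link H W | (2 ^ k.+1 <= #|T|)%N) q ^+ #|T|.
have f0 W : 0 <= f W by apply: sumr_ge0 => T _; rewrite exprn_ge0 // ltW.
have bad : random_subset_prob (24 * q) (fun W => b < f W) <= 1 / 4.
  rewrite -(ler_pM2l b0) div1r.
  apply: le_trans (markov_random_subset q24_0 b0 f0) _.
  have -> : \sum_W random_subset_mass (24 * q) W * f W
    = \sum_W random_subset_mass (24 * q) W *
      (\sum_(T in link H W | (2 ^ k.+1 <= #|T|)%N) (24 * q * (1 / 24)) ^+ #|T|).
    apply: eq_bigr => W _; congr (_ * _); apply: eq_bigr => T _.
    by congr (_ ^+ _); lra.
  have hr : 0 <= (1 / 24 : K) <= 1 by lra.
  apply: le_trans (expected_link_cost_le _ hq hr (fun S SH => ltnW (Hk S SH))) _.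
  rewrite expnS exprM -exprMn.
  have := six_exp_le k.
  rewrite (_ : 2 ^+ 2 * (1 / 24) = 6^-1 :> K); last by field.
  by rewrite exprVn -/b; lra.
rewrite random_subset_probU //.
apply: (@le_trans _ _ (\sum_W random_subset_mass (24 * q) W *
    (c1 + (b < f W)%R%:R * c2))).
  apply: ler_sum => W _; apply: ler_wpM2l; first exact: random_subset_mass_ge0.
  have [fb|bf] := ltP b (f W).
    rewrite mul1r; apply: le_trans (_ : c2 <= _); last by lra.
    apply: le_trans Hc2; apply: random_subset_prob_le => // W2.
    apply: contraNN => /existsP[S /andP[SH SW]]; apply/existsP; exists S.
    by rewrite SH (subset_trans SW) // subsetUr.
  rewrite mul0r addr0; apply: le_trans (IH (small_link H W (2 ^ k.+1)) _ _).
  - apply: random_subset_prob_le => // W2; exact: avoids_small_link.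
  - by move=> S /setIdP[].
  - by apply: covers_exceed_small_link Hc bf; rewrite ltW.
under eq_bigr => W _ do rewrite mulrDr.
rewrite big_split /= -mulr_suml -/(random_subset_prob _ predT) random_subset_probT.
rewrite mul1r lerD2l.
have -> : \sum_W random_subset_mass (24 * q) W * ((b < f W)%R%:R * c2)
    = random_subset_prob (24 * q) (fun W => b < f W) * c2.
  rewrite mulr_suml [RHS]big_mkcond; apply: eq_bigr => W _.
  by case: (b < f W); rewrite ?mul1r ?mul0r ?mulr0.
by rewrite mulrC ler_wpM2l //; lra.
Qed.

Lemma avoid_le p q H k : 0 < q -> 0 <= p < 1 ->
  (forall S, S \in H -> (#|S| < 2 ^ k.+1)%N) ->
  covers_exceed q (1 / 2 - (1 / 2) ^+ k.+2) H ->
  random_subset_prob p (avoids H) <= 4 ^+ k * decay (p / q).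
Proof.
move=> q0; elim: k p H => [|k IHk] p H hp Hk Hc.
  have hp' : 0 <= p <= 1 by lra.
  rewrite mul1r; apply: avoid_singletons_le => //.
  by move=> G /Hc; apply: le_lt_trans; rewrite expr2; lra.
(* Below one round [decay] is at least 1/2, so the claimed bound exceeds 1. *)
have few_rounds r : 0 <= r -> r < 24 * q ->
    random_subset_prob r (avoids H) <= 4 ^+ k.+1 * decay (r / q).
  move=> r0 rq; apply: (le_trans (random_subset_prob_le1 _ r0)).
  have /decay_anti : r / q <= 24 by rewrite ler_pdivrMr // ltW.
  rewrite decay24 exprS; have : 1 <= 4 ^+ k :> K by rewrite exprn_ege1 // ler1n.
  nra.
have [|q24] := ltP p (24 * q); first by apply: few_rounds; case/andP: hp.
have [n] : exists n : nat, p <= n%:R * (24 * q * (1 - p)).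
  exists (Num.bound (p / (24 * q * (1 - p)))).
  rewrite -ler_pdivrMr; last by rewrite !mulr_gt0 //; lra.
  by rewrite ltW // archi_boundP // divr_ge0 ?mulr_ge0 //; lra.
(* With [p = 1 - (1 - 24 q) (1 - p')], the bound [p / (1 - p) <= n * 24 q] on
   the odds passes to [p'] with [n - 1]. *)
elim: n p hp q24 => [|n IHn] p hp q24 pn; first by rewrite mul0r in pn; lra.
have /andP[p0 p1] := hp.
pose p' := (p - 24 * q) / (1 - 24 * q).
have d0 : 0 < 1 - 24 * q by lra.
have p'E : p' * (1 - 24 * q) = p - 24 * q by rewrite divfK ?gt_eqF.
have pE : p = 1 - (1 - 24 * q) * (1 - p') by lra.
have p'0 : 0 <= p' by rewrite divr_ge0 //; lra.
have p'1 : p' < 1 by rewrite ltr_pdivrMr //; lra.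
have hp' : 0 <= p' < 1 by rewrite p'0.
have p'n : p' <= n%:R * (24 * q * (1 - p')).
  rewrite -(ler_pM2r d0) p'E.
  rewrite -[n.+1]addn1 natrD mulrDl mul1r in pn.
  have -> : n%:R * (24 * q * (1 - p')) * (1 - 24 * q) = n%:R * (24 * q * (1 - p)).
    by rewrite pE; ring.
  have := mulr_ge0 (ltW q0) p0; lra.
have fail' : random_subset_prob p' (avoids H) <= 4 ^+ k.+1 * decay (p' / q).
  by have [/few_rounds->//|q24'] := ltP p' (24 * q); apply: IHn.
(* Since [p <= p' + 24 * q], undoing one round at most doubles the decay. *)
have decay' : decay (p' / q) <= 2 * decay (p / q).
  rewrite -decayB24; apply: decay_anti.
  rewrite -(ler_pM2r q0) mulrBl !divfK ?gt_eqF //.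
  have := mulr_ge0 p'0 (ltW q0); lra.
have hp1 : 0 <= p' <= 1 by lra.
have q24_1 : 24 * q <= 1 by lra.
have k0 : 0 <= 4 ^+ k :> K by rewrite exprn_ge0.
have dp0 := decay_ge0 (p' / q).
(* Good and discarded rounds each contribute [4 ^+ k * decay (p' / q)]; with the doubling above, the
   total is at most [4 ^+ k.+1 * decay (p / q)]. This fixes the base 4. *)
have := avoid_round_le q0 q24_1 hp1 Hk Hc (fun H' => IHk p' H' hp')
  (mulr_ge0 k0 dp0) _ fail'.
rewrite -pE exprS => /(_ _)/le_trans; apply; first by rewrite !mulr_ge0.
by nra.
Qed.

End RandomSubsets.

(** * The bound at the prescribed density *)

Theorem theorem3 (K : realType) (X : finType) (q : K) (H : hypergraph X)
    (eps p : K)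
    (hq : 0 < q < 1)
    (hell : (1 <= ell H)%N)
    (hH : ~ q_small q H)
    (heps : 0 < eps < 1)
    (hp : p = 48 * q * log2 ((ell H)%:R / eps)) :
  random_subset_prob p (fun W : {set X} => [exists S in H, S \subset W])
    > 1 - eps.
Proof.
have /andP[q0 q1] := hq; have /andP[e0 e1] := heps.
have [S0 S0H] : exists S, S \in H.
  apply/set0Pn; apply: contraTneq hell => ->.
  by rewrite /ell big_set0.
have [p_ge1|p_lt1] := leP 1 p.
  rewrite random_subset_prob_ge1 // (_ : [exists S in H, _]) ?ltrBlDr ?ltrDl //.
  by apply/existsP; exists S0; rewrite S0H subsetT.
set l := ell H in hell hp *.
have l1 : 1 <= l%:R :> K by rewrite ler1n.
have l0 : 0 < l%:R :> K by lra.
have ln2_gt0 : 0 < ln (2 : K) by rewrite ln_gt0 // ltr1n.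
have le_gt1 : 1 < l%:R / eps by rewrite ltr_pdivlMr //; lra.
have p0 : 0 <= p.
  have := ln_ge0 (ltW le_gt1); rewrite hp /log2 => ?.
  by rewrite !mulr_ge0 ?invr_ge0 // ltW.
have hp01 : 0 <= p < 1 by rewrite p0.
have pred_exceed k : covers_exceed q (1 / 2 - (1 / 2) ^+ k.+2) H.
  move=> G HG; have [small|] := leP (\sum_(R in G) q ^+ #|R|) (1 / 2).
    by case: hH; exists G.
  have : 0 < (1 / 2 : K) ^+ k.+2 by rewrite exprn_gt0 // divr_gt0.
  lra.
pose k := trunc_log 2 l.
have Hk S : S \in H -> (#|S| < 2 ^ k.+1)%N.
  move=> SH; apply: leq_ltn_trans (trunc_log_ltn _ _) => //.
  exact: leq_bigmax_cond.
have fail := avoid_le q0 hp01 Hk (pred_exceed k).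
(* The exponent 2 is 48 / 24. *)
have decayE : decay (p / q) = (eps / l%:R) ^+ 2.
  rewrite /decay (_ : ln 2 / 24 * (p / q) = 2%:R * ln (l%:R / eps)); last first.
    by rewrite hp /log2; field; rewrite !gt_eqF.
  rewrite -mulrN expRM_natl expRN lnK ?invf_div //.
  by rewrite posrE divr_gt0.
(* As [2 ^ k <= l], the factor [4 ^+ k] is cancelled by the [l ^+ 2] in the decay, leaving
   [eps ^+ 2 < eps]. *)
have k_le : 4 ^+ k <= l%:R ^+ 2 :> K.
  rewrite -!natrX ler_nat (_ : 4 = 2 ^ 2)%N // -expnM mulnC expnM leq_exp2r //.
  exact: trunc_logP.
have : random_subset_prob p (avoids H) < eps.
  apply: le_lt_trans fail _; rewrite decayE expr_div_n.
  apply: (@le_lt_trans _ _ (eps ^+ 2)); last by rewrite expr2 gtr_pMr.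
  rewrite mulrCA ger_pMr ?exprn_gt0 // ler_pdivrMr ?exprn_gt0 //.
  by rewrite mul1r.
have <- := random_subset_probC p (fun W : {set X} => [exists S in H, S \subset W]).
by rewrite ltrBlDr ltrD2l.
Qed.
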